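(* Let $d\ge 1$, let $\mathcal{G}$ be a groupoid of germs over $\mathbb{R}^d$, and let $M$ be a closed $\mathcal{G}$-manifold. Let $\Gamma$ be a finitely generated group with property FW. For every homomorphism $\rho\colon\Gamma\to S\mathsf{Homeo}_{\mathcal{G}}(M)$, there exist a closed $\mathcal{G}$-manifold $N$ and a finitely singular $\mathcal{G}$-homeomorphism $\varphi\colon M\to N$ such that the set of singular points of $\varphi\rho(\Gamma)\varphi^{-1}$ is finite and consists of points with a finite $\varphi\rho(\Gamma)\varphi^{-1}$-orbit.
   Context: Germs. Let $X$ be a locally compact Hausdorff space. A germ on $X$ is the class $[h]_x$ of a pair $(h,x)$, where $x\in X$ and $h$ is a homeomorphism from a neighbourhood of $x$ to a neighbourhood of $h(x)$; $(h_1,x_1)\sim(h_2,x_2)$ iff $x_1=x_2$ and $h_1,h_2$ coincide near $x_1$. For $\gamma=[h]_x$ put $s(\gamma)=x$ (source), $t(\gamma)=h(x)$ (target). If $s(\gamma_1)=t(\gamma_2)$ with $\gamma_i=[h_i]_{s(\gamma_i)}$, then $\gamma_1\gamma_2=[h_1h_2]_{s(\gamma_2)}$; and $[h]_x^{-1}=[h^{-1}]_{h(x)}$. A groupoid of germs over $X$ is a set of germs on $X$, closed under products (when defined) and inverses, containing the germ of the identity at every $x\in X$, and such that each of its elements $\gamma$ has a representative $(h,s(\gamma))$ with $[h]_y$ in the set for every $y$ in the domain of $h$. $\mathcal{G}$-manifolds. A $\mathcal{G}$-manifold is a topological $d$-manifold (Hausdorff, second countable) with an atlas whose changes of charts have all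 germs in $\mathcal{G}$; closed means compact without boundary. A homeomorphism between $\mathcal{G}$-manifolds is a $\mathcal{G}$-homeomorphism if in charts all its germs belong to $\mathcal{G}$. A finitely singular $\mathcal{G}$-homeomorphism is a homeomorphism between $\mathcal{G}$-manifolds which is a $\mathcal{G}$-homeomorphism in restriction to the complement of a finite subset. $S\mathsf{Homeo}_{\mathcal{G}}(M)$ is the group of finitely singular $\mathcal{G}$-homeomorphisms from $M$ to itself. A point $x\in N$ is singular for a group $\Lambda$ of homeomorphisms of $N$ if there is $g\in\Lambda$ whose germ at $x$, read in charts, does not belong to $\mathcal{G}$. Property FW: let a group $\Gamma$ act on a set $Y$. A subset $A\subset Y$ is commensurated if $g(A)\triangle A$ is finite for every $g\in\Gamma$; it is transfixed if there is a $\Gamma$-invariant $B\subset Y$ with $A\triangle B$ finite. $\Gamma$ has property FW if for every action of $\Gamma$ on a set, every commensurated subset is transfixed. *)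

(* Defs.v *)
From HB Require Import structures.
From mathcomp Require Import all_boot all_order all_algebra.
From mathcomp Require Import all_classical all_reals all_analysis.

Set Implicit Arguments.
Unset Strict Implicit.
Unset Printing Implicit Defensive.

Local Open Scope classical_set_scope.

(* Homeomorphisms between open subsets [pdom] and [pcod].  The two underlying
   functions are total; their values outside [pdom] and [pcod] are junk.
   Open domains lose no germ: a homeomorphism between neighbourhoods of [x] and
   [h x] restricts to one between open neighbourhoods. *)
Record phomeo (X Y : topologicalType) := Phomeo {
  pdom : set X ;
  pcod : set Y ;
  pfun :> X -> Y ;
  pinv : Y -> X ;
  pdom_open : open pdom ;
  pcod_open : open pcod ;
  pfun_pcod : forall x, pdom x -> pcod (pfun x) ;
  pinv_pdom : forall y, pcod y -> pdom (pinv y) ;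
  pfunK : forall x, pdom x -> pinv (pfun x) = x ;
  pinvK : forall y, pcod y -> pfun (pinv y) = y ;
  pfun_cont : forall x, pdom x -> {for x, continuous pfun} ;
  pinv_cont : forall y, pcod y -> {for y, continuous pinv} }.

Definition phomeo_id (X : topologicalType) : phomeo X X :=
  @Phomeo X X setT setT id id openT openT (fun _ => id) (fun _ => id)
    (fun _ _ => erefl) (fun _ _ => erefl)
    (fun _ _ _ => id) (fun _ _ _ => id).

Definition phomeo_inv (X Y : topologicalType) (f : phomeo X Y) : phomeo Y X :=
  Phomeo (pcod_open f) (pdom_open f) (@pinv_pdom _ _ f) (@pfun_pcod _ _ f)
    (@pinvK _ _ f) (@pfunK _ _ f) (@pinv_cont _ _ f) (@pfun_cont _ _ f).

Lemma open_setI_preim (S T : topologicalType) (A : set S) (B : set T)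
    (f : S -> T) : open A -> open B ->
  (forall x, A x -> {for x, continuous f}) -> open (A `&` f @^-1` B).
Proof.
move=> oA oB cf; rewrite openE => x [Ax Bfx].
apply: filterI; first exact: open_nbhs_nbhs.
by apply: (cf x Ax); apply: open_nbhs_nbhs.
Qed.

Section PhomeoComp.
Variables (X Y Z : topologicalType) (g : phomeo Y Z) (f : phomeo X Y).

Let D := pdom f `&` f @^-1` pdom g.
Let C := pcod g `&` pinv g @^-1` pcod f.

Lemma phomeo_comp_dom_open : open D.
Proof.
apply: open_setI_preim; [exact: pdom_open|exact: pdom_open|].
by move=> x; exact: pfun_cont.
Qed.

Lemma phomeo_comp_cod_open : open C.
Proof.
apply: open_setI_preim; [exact: pcod_open|exact: pcod_open|].
by move=> x; exact: pinv_cont.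
Qed.

Lemma phomeo_comp_cod x : D x -> C (g (f x)).
Proof.
move=> [fx gx]; split; first exact: pfun_pcod.
by rewrite /preimage/= pfunK//; exact: pfun_pcod.
Qed.

Lemma phomeo_comp_dom z : C z -> D (pinv f (pinv g z)).
Proof.
move=> [gz fz]; split; first exact: pinv_pdom.
by rewrite /preimage/= pinvK//; exact: pinv_pdom.
Qed.

Lemma phomeo_compK x : D x -> pinv f (pinv g (g (f x))) = x.
Proof. by move=> [fx gx]; rewrite !pfunK. Qed.

Lemma phomeo_compVK z : C z -> g (f (pinv f (pinv g z))) = z.
Proof. by move=> [gz fz]; rewrite !pinvK. Qed.

Lemma phomeo_comp_cont x : D x -> {for x, continuous (g \o f)}.
Proof. by move=> [fx gx]; apply: continuous_comp; exact: pfun_cont. Qed.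

Lemma phomeo_compV_cont z : C z -> {for z, continuous (pinv f \o pinv g)}.
Proof. by move=> [gz fz]; apply: continuous_comp; exact: pinv_cont. Qed.

Definition phomeo_comp : phomeo X Z :=
  @Phomeo X Z D C (g \o f) (pinv f \o pinv g)
    phomeo_comp_dom_open phomeo_comp_cod_open phomeo_comp_cod phomeo_comp_dom
    phomeo_compK phomeo_compVK phomeo_comp_cont phomeo_compV_cont.

End PhomeoComp.

(* The germ of [h] at [x], as an equivalence class of pairs (homeomorphism,
   base point).  Only meaningful when [pdom h x]. *)
Definition germ (X : topologicalType) (h : phomeo X X) (x : X) :
    set (phomeo X X * X) :=
  [set p | [/\ p.2 = x, pdom p.1 x & \forall y \near x, p.1 y = h y]].

(* [germs_local] also says that every element of [germs] is a germ. *)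
Record germ_groupoid (X : topologicalType) := GermGroupoid {
  germs : set (set (phomeo X X * X)) ;
  germs_local : forall c, germs c -> exists h x,
    [/\ pdom h x, c = germ h x & forall y, pdom h y -> germs (germ h y)] ;
  germs_id : forall x, germs (germ (phomeo_id X) x) ;
  germs_mul : forall (h1 h2 : phomeo X X) x, pdom h2 x -> pdom h1 (h2 x) ->
    germs (germ h1 (h2 x)) -> germs (germ h2 x) ->
    germs (germ (phomeo_comp h1 h2) x) ;
  germs_inv : forall (h : phomeo X X) x, pdom h x ->
    germs (germ h x) -> germs (germ (phomeo_inv h) (h x)) }.

(* Manifolds modelled on [X]; the empty manifold is allowed. *)
Record gmanifold (X : topologicalType) (G : germ_groupoid X) := GManifold {
  gcarrier :> topologicalType ;
  ghausdorff : hausdorff_space gcarrier ;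
  gsecond_countable : @second_countable gcarrier ;
  atlas : set (phomeo gcarrier X) ;
  atlas_cover : forall x, exists2 u, atlas u & pdom u x ;
  atlas_change : forall u v x, atlas u -> atlas v -> pdom u x -> pdom v x ->
    germs G (germ (phomeo_comp v (phomeo_inv u)) (u x)) }.

Definition closed_manifold (X : topologicalType) (G : germ_groupoid X)
  (M : gmanifold G) := compact [set: M].

Record homeo (S T : topologicalType) := Homeo {
  hfun :> S -> T ;
  hinv : T -> S ;
  hfunK : cancel hfun hinv ;
  hinvK : cancel hinv hfun ;
  hfun_cont : continuous hfun ;
  hinv_cont : continuous hinv }.

Definition homeo_id (S : topologicalType) : homeo S S :=
  @Homeo S S id id (frefl _) (frefl _) (fun _ _ => id) (fun _ _ => id).

Definition homeo_inv (S T : topologicalType) (f : homeo S T) : homeo T S :=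
  Homeo (@hinvK _ _ f) (@hfunK _ _ f) (@hinv_cont _ _ f) (@hfun_cont _ _ f).

Definition homeo_comp (S T U : topologicalType) (g : homeo T U)
    (f : homeo S T) : homeo S U :=
  @Homeo S U (g \o f) (hinv f \o hinv g)
    (can_comp (@hfunK _ _ g) (@hfunK _ _ f))
    (can_comp (@hinvK _ _ f) (@hinvK _ _ g))
    (fun x => continuous_comp (@hfun_cont _ _ f x) (@hfun_cont _ _ g (f x)))
    (fun x => continuous_comp (@hinv_cont _ _ g x)
                              (@hinv_cont _ _ f (hinv g x))).

Definition phomeo_of_homeo (S T : topologicalType) (f : homeo S T) :
    phomeo S T :=
  @Phomeo S T setT setT f (hinv f) openT openT (fun _ => id) (fun _ => id)
    (fun x _ => @hfunK _ _ f x) (fun y _ => @hinvK _ _ f y)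
    (fun x _ => @hfun_cont _ _ f x) (fun y _ => @hinv_cont _ _ f y).
Coercion phomeo_of_homeo : homeo >-> phomeo.

Lemma homeo_eq (S T : topologicalType) (f g : homeo S T) : f =1 g -> f = g.
Proof.
case: f g => [f f' fK f'K cf cf'] [g g' gK g'K cg cg'] /= fg.
have {}fg : f = g by apply/funext.
subst g; have fg' : f' = g'.
  by apply/funext => y; rewrite -{1}(g'K y) fK.
by subst g'; congr Homeo; exact: Prop_irrelevance.
Qed.

(* [h], read in charts, has its germ at [x] in [G]; by closure of [G]
   under products the choice of charts is irrelevant. *)
Definition regular_at (X : topologicalType) (G : germ_groupoid X)
    (M N : gmanifold G) (h : homeo M N) (x : M) : Prop :=
  forall u v, atlas u -> atlas v -> pdom u x -> pdom v (h x) ->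
    germs G (germ (phomeo_comp v (phomeo_comp h (phomeo_inv u))) (u x)).

Definition finitely_singular (X : topologicalType) (G : germ_groupoid X)
    (M N : gmanifold G) (h : homeo M N) : Prop :=
  exists2 F : set M, finite_set F & forall x, ~ F x -> regular_at h x.

Section HomeoGroup.
Variable S : topologicalType.

HB.instance Definition _ := gen_eqMixin (homeo S S).
HB.instance Definition _ := gen_choiceMixin (homeo S S).

Let mul (g f : homeo S S) := homeo_comp g f.

Lemma homeo_mulA : associative mul.
Proof. by move=> h g f; exact: homeo_eq. Qed.

Lemma homeo_mul1 : left_id (homeo_id S) mul.
Proof. by move=> f; exact: homeo_eq. Qed.

Lemma homeo_mulr1 : right_id (homeo_id S) mul.
Proof. by move=> f; exact: homeo_eq. Qed.

Lemma homeo_mulV : left_inverse (homeo_id S) (@homeo_inv S S) mul.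
Proof. by move=> f; apply: homeo_eq => x; exact: hfunK. Qed.

Lemma homeo_mulrV : right_inverse (homeo_id S) (@homeo_inv S S) mul.
Proof. by move=> f; apply: homeo_eq => x; exact: hinvK. Qed.

HB.instance Definition _ := isGroup.Build (homeo S S)
  homeo_mulA homeo_mul1 homeo_mulr1 homeo_mulV homeo_mulrV.

End HomeoGroup.

Lemma eq_germ (X : topologicalType) (h k : phomeo X X) (x : X) :
  (\forall y \near x, h y = k y) -> germ h x = germ k x.
Proof.
move=> hk; apply/seteqP; split => p [px dp ph]; split => //.
- by apply: filterS2 ph hk => y -> ->.
- by apply: filterS2 ph hk => y -> ->.
Qed.

Section FinitelySingularGroup.
Context (X : topologicalType) (G : germ_groupoid X).
Implicit Types M N P : gmanifold G.

Lemma regular_at_id M (x : M) : @regular_at X G M M (homeo_id M) x.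
Proof.
move=> u v au av ux vx.
exact: atlas_change au av ux vx.
Qed.

Lemma regular_at_comp M N P (g : homeo N P) (f : homeo M N) (x : M) :
  regular_at f x -> regular_at g (f x) -> regular_at (homeo_comp g f) x.
Proof.
move=> rf rg u w au aw ux wx.
have [v av vfx] := atlas_cover (f x).
have dfx : pdom (phomeo_comp v (phomeo_comp f (phomeo_inv u))) (u x).
  split; first by split => //; exact: pfun_pcod.
  by rewrite /preimage/= pfunK.
have := rf _ _ au av ux vfx; have := rg _ _ av aw vfx wx.
set k := phomeo_comp w _; set l := phomeo_comp v _ => Gk Gl.
have lux : l (u x) = v (f x) by rewrite /l/= pfunK.
rewrite -lux in Gk.
have dk : pdom k (l (u x)).
  rewrite lux; split; first by split => //; exact: pfun_pcod.
  by rewrite /preimage/= pfunK.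
have := germs_mul dfx dk Gk Gl.
congr (germs G _); apply: eq_germ.
have : nbhs (u x) (pdom l) by apply: open_nbhs_nbhs; split=> //; exact: pdom_open.
by apply: filterS => y [_ vy] /=; rewrite pfunK.
Qed.

Lemma regular_at_inv M N (f : homeo M N) (x : M) :
  regular_at f x -> regular_at (homeo_inv f) (f x).
Proof.
move=> rf u v au av ux; rewrite /= hfunK => vx.
have := rf _ _ av au vx ux.
set k := phomeo_comp u _ => Gk.
have kx : k (v x) = u (f x) by rewrite /k/= pfunK.
have dk : pdom k (v x).
  split; first by split => //; exact: pfun_pcod.
  by rewrite /preimage/= pfunK.
have := germs_inv dk Gk; rewrite kx.
by congr (germs G _); apply: eq_germ; exact: nearW.
Qed.

Lemma finitely_singular_group M :
  group_closed (fun f : homeo M M => `[< finitely_singular f >]).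
Proof.
split => [|f g]; first by apply/asboolP; exists set0 => // x _; exact: regular_at_id.
move=> /asboolP[F finF rF] /asboolP[E finE rE]; apply/asboolP.
exists (g @` (F `|` E)).
  by apply: finite_image; rewrite finite_setU.
move=> y nFEy; have gy : g (hinv g y) = y by exact: hinvK.
rewrite -gy; apply: regular_at_comp.
  by apply: regular_at_inv; apply: rE => Ey; apply: nFEy; exists (hinv g y); [right|].
by rewrite /= hfunK; apply: rF => Fy; apply: nFEy; exists (hinv g y); [left|].
Qed.

End FinitelySingularGroup.

Section SHomeo.
Context (X : topologicalType) (G : germ_groupoid X) (M : gmanifold G).

Definition SHomeo := {f : homeo M M | `[< finitely_singular f >]}.

HB.instance Definition _ := [isSub for (@sval _ _ : SHomeo -> homeo M M)].
HB.instance Definition _ := [Choice of SHomeo by <:].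
HB.instance Definition _ := SubChoice_isSubGroup.Build _ _ SHomeo
  (finitely_singular_group M).

End SHomeo.

(* Groups of homeomorphisms are given below by their sets of elements. *)
Definition conj_group (S T : topologicalType) (f : homeo S T)
    (L : set (homeo S S)) : set (homeo T T) :=
  [set homeo_comp f (homeo_comp g (homeo_inv f)) | g in L].

Definition singular_point (X : topologicalType) (G : germ_groupoid X)
    (N : gmanifold G) (L : set (homeo N N)) : set N :=
  [set x | exists2 g, L g & ~ regular_at g x].

Definition orbit_of (S : topologicalType) (L : set (homeo S S)) (x : S) :
    set S :=
  [set g x | g in L].

Definition finitely_generated (Gam : groupType) : Prop :=
  exists s : seq Gam, forall H : {pred Gam},
    group_closed H -> {subset s <= H} -> forall g, g \in H.

Section PropertyFW.
Context (Gam : groupType).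
Local Open Scope group_scope.

Definition group_action (Y : Type) (act : Gam -> Y -> Y) : Prop :=
  (forall y, act 1 y = y) /\
  (forall g h y, act (g * h) y = act g (act h y)).

Definition commensurated (Y : Type) (act : Gam -> Y -> Y) (A : set Y) : Prop :=
  forall g, finite_set ((act g @` A) `+` A).

Definition transfixed (Y : Type) (act : Gam -> Y -> Y) (A : set Y) : Prop :=
  exists2 B : set Y, (forall g, act g @` B = B) & finite_set (A `+` B).

Definition property_FW : Prop :=
  forall (Y : Type) (act : Gam -> Y -> Y), group_action act ->
  forall A : set Y, commensurated act A -> transfixed act A.

End PropertyFW.

(* Main.v *)
(* Let [SHomeo M] act on the set of germs of G-structures at points of [M],
   i.e. of germs of charts modulo G.  The set A of germs of the structure of
   [M] is commensurated, because an element of [SHomeo M] preserves it at all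
   but finitely many points.  Property FW yields an invariant B differing from
   A by a finite set.  So, outside of a finite set, the fibre of B over x is
   reduced to the given structure at x.  Keep among B the germs that agree with
   [M] on a punctured neighbourhood of their base point, and let N be [M] with
   the structure changed to the element of B at those x whose fibre is a
   singleton.  An element of the group is then regular wherever the fibre is a
   singleton, and the finitely many other points form an invariant set. *)
Require Import Defs.
From HB Require Import structures.
From mathcomp Require Import all_boot all_order all_algebra.
From mathcomp Require Import all_classical all_reals all_analysis.

Set Implicit Arguments.
Unset Strict Implicit.
Unset Printing Implicit Defensive.

Import numFieldNormedType.Exports.

Local Open Scope classical_set_scope.

(** * Equality and restriction of partial homeomorphisms *)

Lemma phomeo_eq (S T : topologicalType) (f g : phomeo S T) :
  pdom f = pdom g -> pcod f = pcod g -> f = g :> (S -> T) -> Defs.pinv f = Defs.pinv g ->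
  f = g.
Proof.
case: f g => [D C f f' ? ? ? ? ? ? ? ?] [E B g g' ? ? ? ? ? ? ? ?] /= DE CB fg fg'.
by subst E B g g'; congr Phomeo; exact: Prop_irrelevance.
Qed.

Lemma phomeo_comp_id (S T : topologicalType) (f : phomeo S T) :
  phomeo_comp f (homeo_id S) = f.
Proof. by apply: phomeo_eq => //=; rewrite ?setTI// preimage_setT setIT. Qed.

Lemma phomeo_comp_homeoA (S T U V : topologicalType) (f : phomeo U V)
    (g : homeo T U) (h : homeo S T) :
  phomeo_comp (phomeo_comp f g) h = phomeo_comp f (homeo_comp g h).
Proof.
by apply: phomeo_eq => //=; rewrite ?setTI ?preimage_setT ?setIT.
Qed.

Section PhomeoRestrict.
Context (S T : topologicalType) (f : phomeo S T) (U : set S) (oU : open U).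

Definition phomeo_restrict : phomeo S T.
Proof.
refine (@Phomeo S T (pdom f `&` U) (pcod f `&` Defs.pinv f @^-1` U) f (Defs.pinv f)
  _ _ _ _ _ _ _ _).
- exact: openI (pdom_open f) oU.
- by apply: open_setI_preim => //; [exact: pcod_open|exact: pinv_cont].
- by move=> x [fx Ux]; split; [exact: pfun_pcod|rewrite /preimage/= pfunK].
- by move=> y [fy Uy]; split => //; exact: pinv_pdom.
- by move=> x [fx _]; exact: pfunK.
- by move=> y [fy _]; exact: Defs.pinvK.
- by move=> x [fx _]; exact: pfun_cont.
- by move=> y [fy _]; exact: pinv_cont.
Defined.

End PhomeoRestrict.

(** * Germs of G-structures at a point *)

Section Compatibility.
Context (X : topologicalType) (G : germ_groupoid X).

(** Meaningful when both charts are defined at [x]: they then induce the same germ of G-structure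
    there. *)
Definition compatible (S : topologicalType) (v u : phomeo S X) (x : S) : Prop :=
  germs G (germ (phomeo_comp v (phomeo_inv u)) (u x)).

Section Charts.
Context (S : topologicalType).
Implicit Types (u v w : phomeo S X) (x : S).

Lemma compatible_refl u x : pdom u x -> compatible u u x.
Proof.
move=> ux; rewrite /compatible; have := germs_id G (u x).
congr (germs G _); apply: eq_germ.
have : nbhs (u x) (pcod u).
  by apply: open_nbhs_nbhs; split; [exact: pcod_open|exact: pfun_pcod].
by apply: filterS => y uy /=; rewrite Defs.pinvK.
Qed.

Lemma pdom_change u v x : pdom u x -> pdom v x ->
  pdom (phomeo_comp v (phomeo_inv u)) (u x).
Proof.
by move=> ux vx; split; [exact: pfun_pcod|rewrite /preimage/= pfunK].
Qed.

Lemma compatible_sym u v x : pdom u x -> pdom v x ->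
  compatible v u x -> compatible u v x.
Proof.
move=> ux vx uv; have := germs_inv (pdom_change ux vx) uv.
by rewrite /compatible /= pfunK.
Qed.

Lemma compatible_trans v u w x : pdom u x -> pdom v x -> pdom w x ->
  compatible v u x -> compatible w v x -> compatible w u x.
Proof.
move=> ux vx wx uv vw.
have e : phomeo_comp v (phomeo_inv u) (u x) = v x by rewrite /= pfunK.
have dvw : pdom (phomeo_comp w (phomeo_inv v))
    (phomeo_comp v (phomeo_inv u) (u x)) by rewrite e; exact: pdom_change.
have Gvw : germs G (germ (phomeo_comp w (phomeo_inv v))
    (phomeo_comp v (phomeo_inv u) (u x))) by rewrite e.
have := germs_mul (pdom_change ux vx) dvw Gvw uv.
congr (germs G _); apply: eq_germ.
have : nbhs (u x) (pdom (phomeo_comp v (phomeo_inv u))).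
  by apply: open_nbhs_nbhs; split; [exact: pdom_open|exact: pdom_change].
by apply: filterS => y [_ vy] /=; rewrite pfunK.
Qed.

Lemma compatible_restrictl u v x (U : set S) (oU : open U) :
  compatible (phomeo_restrict v oU) u x <-> compatible v u x.
Proof.
by rewrite /compatible (@eq_germ _ _ (phomeo_comp v (phomeo_inv u)))//; exact: nearW.
Qed.

(** A germ of G-structure is encoded as a class of charts. Each chart is paired with its base point,
    so that germs at distinct points are distinct. *)
Definition structure_germ u x : set (phomeo S X * S) :=
  [set p | [/\ p.2 = x, pdom p.1 x & compatible p.1 u x]].

Lemma structure_germ_refl u x : pdom u x -> structure_germ u x (u, x).
Proof. by move=> ux; split => //; exact: compatible_refl. Qed.

Lemma eq_structure_germ u v x : pdom u x -> pdom v x ->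
  compatible v u x -> structure_germ v x = structure_germ u x.
Proof.
move=> ux vx uv; apply/seteqP; split => -[w y] [/= yx wx c]; split => //=.
  exact: (compatible_trans ux vx wx uv c).
exact: (compatible_trans vx ux wx (compatible_sym ux vx uv) c).
Qed.

Lemma structure_germ_compatible u v x : pdom v x ->
  structure_germ v x = structure_germ u x -> compatible v u x.
Proof. by move=> vx e; have := structure_germ_refl vx; rewrite e => -[]. Qed.

End Charts.

Section Transport.
Context (S T : topologicalType) (h : homeo S T).
Implicit Types (u : phomeo S X) (v w : phomeo T X) (x : S).

(** Near the image of [x] in the chart [u], both changes of charts are [v] after [h] after the
    inverse of [u]. *)
Lemma compatible_transport u v x :
  compatible v (phomeo_comp u (homeo_inv h)) (h x) <->
  compatible (phomeo_comp v h) u x.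
Proof.
rewrite /compatible /= hfunK.
by rewrite (@eq_germ _ _ (phomeo_comp (phomeo_comp v h) (phomeo_inv u)))//; exact: nearW.
Qed.

Lemma compatible_pullback v w x :
  compatible (phomeo_comp w h) (phomeo_comp v h) x <-> compatible w v (h x).
Proof.
rewrite /compatible (@eq_germ _ _ (phomeo_comp w (phomeo_inv v)))//.
by apply: nearW => y /=; rewrite hinvK.
Qed.

End Transport.

Lemma regular_atP (M N : gmanifold G) (h : homeo M N) (x : M) :
  regular_at h x <-> forall u v, atlas u -> atlas v -> pdom u x ->
    pdom v (h x) -> compatible (phomeo_comp v h) u x.
Proof.
have e (u : phomeo M X) (v : phomeo N X) :
    germ (phomeo_comp v (phomeo_comp h (phomeo_inv u))) (u x) =
    germ (phomeo_comp (phomeo_comp v h) (phomeo_inv u)) (u x).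
  by apply: eq_germ; exact: nearW.
by split => r u v au av ux vx; have := r u v au av ux vx; rewrite /compatible e.
Qed.

End Compatibility.

(** * Action of homeomorphisms on germs of structures, and commensuration *)

Section Action.
Context (X : topologicalType) (G : germ_groupoid X).

(* Acts on all sets of pointed charts, so that no subtype of germs of
   G-structures is needed; see [act_structure_germ]. *)
Definition act_germ (S : topologicalType) (h : homeo S S)
    (c : set (phomeo S X * S)) : set (phomeo S X * S) :=
  [set p | c (phomeo_comp p.1 h, hinv h p.2)].

Lemma act_germ1 (S : topologicalType) (c : set (phomeo S X * S)) :
  act_germ (homeo_id S) c = c.
Proof. by apply/seteqP; split => -[u x]; rewrite /act_germ /= phomeo_comp_id. Qed.

Lemma act_germM (S : topologicalType) (g h : homeo S S) c :
  act_germ (homeo_comp g h) c = act_germ g (act_germ h c).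
Proof.
by apply/seteqP; split => -[u x]; rewrite /act_germ /= phomeo_comp_homeoA.
Qed.

Lemma act_structure_germ (S : topologicalType) (h : homeo S S)
    (u : phomeo S X) (x : S) :
  act_germ h (structure_germ G u x) =
  structure_germ G (phomeo_comp u (homeo_inv h)) (h x).
Proof.
apply/seteqP; split => -[v y] [/= yx].
  move=> [_ vx] /compatible_transport uv; split => //=.
  by rewrite -yx hinvK.
move=> vx /compatible_transport uv; split => //=.
by rewrite yx hfunK.
Qed.

Variable M : gmanifold G.
Implicit Types (u v : phomeo M X) (x : M) (h : homeo M M).

Definition manifold_germ x : set (phomeo M X * M) :=
  [set p | exists2 u, atlas u /\ pdom u x & structure_germ G u x p].

Lemma manifold_germE u x : atlas u -> pdom u x ->
  manifold_germ x = structure_germ G u x.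
Proof.
move=> au ux; apply/seteqP; split => p; last by move=> ?; exists u.
move=> [v [av vx]]; rewrite (@eq_structure_germ _ _ _ u v)//.
exact: atlas_change.
Qed.

Lemma act_manifold_germ h x : regular_at h x ->
  act_germ h (manifold_germ x) = manifold_germ (h x).
Proof.
move=> /regular_atP r.
have [u au ux] := atlas_cover x; have [v av vx] := atlas_cover (h x).
rewrite (manifold_germE au ux) (manifold_germE av vx) act_structure_germ.
apply/esym/eq_structure_germ => //; first by split => //; rewrite /preimage/= hfunK.
by apply/compatible_transport; exact: r.
Qed.

(** At a regular point [h] carries the germ of [M] to the germ of [M]. The difference thus comes
    from a finite set [F] containing all singular points: images of germs over [F], and germs over
    [h] of [F]. *)
Lemma finite_act_manifold_germ h : finitely_singular h ->
  finite_set ((act_germ h @` range manifold_germ) `+` range manifold_germ).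
Proof.
move=> [F finF rF].
apply: (@sub_finite_set _ _ ((act_germ h \o manifold_germ) @` F `|`
  (manifold_germ \o h) @` F)); last first.
  by rewrite finite_setU; split; exact: finite_image.
move=> c [[[_ [x _ <-] <-] nA]|[[y _ <-] nB]].
  left; exists x => //; apply: contrapT => nFx; apply: nA.
  by exists (h x) => //; rewrite act_manifold_germ//; exact: rF.
right; exists (hinv h y); last by rewrite /= hinvK.
apply: contrapT => nFx; apply: nB.
exists (manifold_germ (hinv h y)); first by exists (hinv h y).
by rewrite act_manifold_germ ?hinvK//; exact: rF.
Qed.

(** At [x] itself [u] may induce another structure than that of [M]; these are the charts that can
    replace the structure at the single point [x]. *)
Definition punctured_chart u x : Prop :=
  pdom u x /\ \forall y \near x, y <> x ->
    forall v, atlas v -> pdom v y -> compatible G v u y.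

Lemma atlas_punctured_chart u x : atlas u -> pdom u x -> punctured_chart u x.
Proof.
move=> au ux; split => //.
have : nbhs x (pdom u) by apply: open_nbhs_nbhs; split => //; exact: pdom_open.
by apply: filterS => y uy _ v av vy; exact: atlas_change.
Qed.

Lemma near_notin_finite (F : set M) x : finite_set F ->
  \forall y \near x, y <> x -> ~ F y.
Proof.
move=> finF.
have cF : closed (F `\ x).
  have /accessible_finite_set_closed := hausdorff_accessible (@ghausdorff _ _ M).
  by apply; exact: finite_setD.
have : nbhs x (~` (F `\ x)).
  by apply: open_nbhs_nbhs; split; [exact: closed_openC|case=> _; exact].
by apply: filterS => y nFy yx Fy; exact: nFy.
Qed.

(** A finite set misses some punctured neighbourhood of [x], so there [h] is regular and preserves
    the structure of [M]. *)
Lemma punctured_chart_transport h u x : finitely_singular h ->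
  punctured_chart u x -> punctured_chart (phomeo_comp u (homeo_inv h)) (h x).
Proof.
move=> [F finF rF] [ux nu]; split; first by split => //; rewrite /preimage/= hfunK.
have ch : hinv h y @[y --> h x] --> x.
  by have := @hinv_cont _ _ h (h x); rewrite /continuous_at hfunK.
have nux : nbhs x (pdom u).
  by apply: open_nbhs_nbhs; split => //; exact: pdom_open.
have pull (P : set M) : nbhs x P -> nbhs (h x) (hinv h @^-1` P) by exact: ch.
apply: filterS3 (pull _ nux) (pull _ nu) (pull _ (near_notin_finite x finF)).
move=> y uy cy nFy yhx v av vy.
have yx : hinv h y <> x by move=> e; apply: yhx; rewrite -e hinvK.
have [w aw wy] := atlas_cover (hinv h y).
rewrite -(hinvK h y); apply/compatible_transport.
apply: (compatible_trans uy wy _ (cy yx _ aw wy)).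
  by split => //; rewrite /preimage/= hinvK.
have /regular_atP := rF _ (nFy yx).
by apply => //; rewrite hinvK.
Qed.

End Action.

(** * Changing the structure at finitely many points *)

Section Regluing.
Context (X : topologicalType) (G : germ_groupoid X) (M : gmanifold G).
Variables (F : set M) (sigma : M -> phomeo M X).
Hypothesis finF : finite_set F.
Hypothesis sigmaP : forall x, punctured_chart (sigma x) x.
Hypothesis sigma_atlas : forall x, ~ F x -> atlas (sigma x).

Definition regluing_atlas : set (phomeo M X) :=
  [set u | forall x, pdom u x -> compatible G u (sigma x) x].

(** A small restriction of [sigma x] works: a nearby [y] other than [x] lies outside [F], so
    [sigma y] is a chart of [M], with which [sigma x] is compatible at [y]. *)
Lemma regluing_atlas_cover x : exists2 u, regluing_atlas u & pdom u x.
Proof.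
have [sx nsx] := sigmaP x.
have : nbhs x [set y | pdom (sigma x) y /\ compatible G (sigma x) (sigma y) y].
  have nd : nbhs x (pdom (sigma x)).
    by apply: open_nbhs_nbhs; split => //; exact: pdom_open.
  apply: filterS3 nd nsx (near_notin_finite x finF) => y sxy cy nFy; split => //.
  (* At [x] itself the punctured condition says nothing, but the two charts coincide. *)
  have [->|/eqP yx] := eqVneq y x; first exact: compatible_refl.
  have [sy _] := sigmaP y.
  by apply: compatible_sym => //; apply: cy => //; apply: sigma_atlas; exact: nFy.
rewrite nbhsE => -[U [oU Ux] UP].
exists (phomeo_restrict (sigma x) oU) => //.
by move=> y [_ Uy]; apply/compatible_restrictl; case: (UP y Uy).
Qed.

Lemma regluing_atlas_change u v x : regluing_atlas u -> regluing_atlas v ->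
  pdom u x -> pdom v x -> compatible G v u x.
Proof.
move=> au av ux vx; have [sx _] := sigmaP x.
apply: (compatible_trans ux sx vx); last exact: av.
by apply: compatible_sym => //; exact: au.
Qed.

Definition regluing : gmanifold G :=
  GManifold (@ghausdorff _ _ M) (@gsecond_countable _ _ M)
    regluing_atlas_cover regluing_atlas_change.

Definition to_regluing : homeo M regluing := homeo_id M.

Lemma to_regluing_finitely_singular : finitely_singular to_regluing.
Proof.
exists F => // x nFx; apply/regular_atP => u v au av ux vx.
rewrite phomeo_comp_id; have [sx _] := sigmaP x.
apply: (compatible_trans ux sx vx); last exact: av.
exact: atlas_change au (sigma_atlas nFx) ux sx.
Qed.

Lemma regluing_regular_at (h : homeo M M) (x : M) :
  act_germ h (structure_germ G (sigma x) x) =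
    structure_germ G (sigma (h x)) (h x) ->
  @regular_at _ _ regluing regluing h x.
Proof.
rewrite act_structure_germ => /esym e.
have [sx _] := sigmaP x; have [shx _] := sigmaP (h x).
have /compatible_transport c := structure_germ_compatible shx e.
apply/regular_atP => u v au av ux vx.
apply: (@compatible_trans _ _ _ (sigma x)) => //.
  by apply: compatible_sym => //; exact: au.
apply: (@compatible_trans _ _ _ (phomeo_comp (sigma (h x)) h)) => //.
by apply/compatible_pullback; exact: av.
Qed.

End Regluing.

(** * Fibres of a set of germs close to the structure of [M] *)

Section Fibers.
Context (X : topologicalType) (G : germ_groupoid X) (M : gmanifold G).
Variable B : set (set (phomeo M X * M)).

(** [B] may contain arbitrary sets of pointed charts; the second clause keeps the germs at [x] that
    can be glued into [M]. *)
Definition germ_fiber (x : M) : set (set (phomeo M X * M)) :=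
  [set c | B c /\ exists2 u, punctured_chart u x & c = structure_germ G u x].

Lemma germ_fiber_act (h : homeo M M) (x : M) c : finitely_singular h ->
  act_germ h @` B = B -> germ_fiber x c -> germ_fiber (h x) (act_germ h c).
Proof.
move=> sh hB [Bc [u pu cE]]; split; first by rewrite -hB; exists c.
exists (phomeo_comp u (homeo_inv h)); first exact: punctured_chart_transport.
by rewrite cE act_structure_germ.
Qed.

Definition fiber_discrepancy : set M :=
  [set x | germ_fiber x <> [set manifold_germ x]].

(** A structure germ determines its base point, so the finite symmetric difference lies over
    finitely many points. Over any other point, [B] and the structure of [M] have the same germs. *)
Lemma finite_fiber_discrepancy :
  finite_set (range (@manifold_germ _ G M) `+` B) ->
  finite_set fiber_discrepancy.
Proof.
move=> finD.
pose base (c : set (phomeo M X * M)) :=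
  [set x | exists2 u, pdom u x & c = structure_germ G u x].
apply: (@sub_finite_set _ _
  (\bigcup_(c in range (@manifold_germ _ G M) `+` B) base c)); last first.
  apply: bigcup_finite => // c _.
  have [->|/set0P[x [u ux cE]]] := eqVneq (base c) set0; first exact: finite_set0.
  apply: (@sub_finite_set _ _ [set x]); last exact: finite_set1.
  move=> y [v vy]; rewrite cE => e.
  by have := structure_germ_refl G vy; rewrite -e => -[].
move=> x; apply: contra_notP => nbase.
have agree c : base c x -> range (@manifold_germ _ G M) c <-> B c.
  move=> bc; split => [Ac|Bc]; apply: contrapT => nc; apply: nbase;
    exists c => //; [by left|by right].
have [u au ux] := atlas_cover x.
apply/seteqP; split => c.
  move=> [Bc [v [vx _] cE]].
  (* So [c] is the germ of [M] at some [y], and the base point of [(v, x)] in [c] forces [y] to be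
     [x]. *)
  have /agree[_ /(_ Bc)[y _ yc]] : base c x by exists v.
  have [w aw wy] := atlas_cover y.
  have := structure_germ_refl G vx.
  by rewrite -cE -yc (manifold_germE aw wy) => -[/= -> _ _]; rewrite (manifold_germE aw).
move=> ->; split; last first.
  by exists u; [exact: atlas_punctured_chart|exact: manifold_germE].
by apply/agree; [exists u => //; exact: manifold_germE|exists x].
Qed.

(** Provides the charts for regluing: one representing the element of a singleton fibre, and by
    default a chart of [M]. *)
Lemma fiber_chart (x : M) : exists u : phomeo M X,
  [/\ punctured_chart u x,
      ~ fiber_discrepancy x -> atlas u &
      forall c, germ_fiber x = [set c] -> c = structure_germ G u x].
Proof.
have [u au ux] := atlas_cover x.
have [Bx|nBx] := pselect (germ_fiber x = [set manifold_germ x]).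
  exists u; split => //; first exact: atlas_punctured_chart.
  move=> c; rewrite Bx -(manifold_germE au ux) => e.
  by have : [set manifold_germ x] (manifold_germ x) by []; rewrite e.
have [[c Bx]|nB] := pselect (exists c, germ_fiber x = [set c]).
  have : germ_fiber x c by rewrite Bx.
  move=> [_ [v pv cE]]; exists v; split => // b; rewrite Bx -cE => e.
  by have : [set c] c by []; rewrite e.
exists u; split => //; first exact: atlas_punctured_chart.
by move=> c Bx; case: nB; exists c.
Qed.

End Fibers.

Theorem theorem3p6 (R : realType) (d : nat) (hd : (1 <= d)%N)
  (G : germ_groupoid 'rV[R]_d) (M : gmanifold G) (hM : closed_manifold M)
  (Gam : groupType) (hfg : finitely_generated Gam) (hFW : property_FW Gam)
  (rho : {multiplicative Gam -> SHomeo M}) :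
  exists (N : gmanifold G) (phi : homeo M N),
    [/\ closed_manifold N,
        finitely_singular phi &
        let L := conj_group phi [set val (rho g) | g in [set: Gam]] in
        finite_set (singular_point L) /\
        forall x, singular_point L x -> finite_set (orbit_of L x)].
Proof.
pose act (g : Gam) := act_germ (X := 'rV[R]_d) (val (rho g)).
have rho1 : val (rho 1%g) = homeo_id M.
  have -> // : rho 1%g = 1%g.
  by apply: (mulgI (rho 1%g)); rewrite -gmulfM !mulg1.
have rhoM g h : val (rho (g * h)%g) = homeo_comp (val (rho g)) (val (rho h)).
  by rewrite gmulfM.
have rhoV g x : val (rho g^-1%g) (val (rho g) x) = x.
  have : homeo_comp (val (rho g^-1%g)) (val (rho g)) = homeo_id M.
    by rewrite -rhoM mulVg.
  by move=> /(congr1 (fun f : homeo M M => f x)).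
have sing g : finitely_singular (val (rho g)).
  exact/asboolP/(valP (rho g)).
have actP : group_action act.
  split => [c|g h c]; first by rewrite /act rho1 act_germ1.
  by rewrite /act rhoM act_germM.
have [B invB finB] : transfixed act (range (@manifold_germ _ G M)).
  by apply: hFW => // g; exact: finite_act_manifold_germ.
have [sigma sigmaP] := choice (fiber_chart B).
have finF := finite_fiber_discrepancy finB.
have s1 x : punctured_chart (sigma x) x by case: (sigmaP x).
have s2 x : ~ fiber_discrepancy B x -> atlas (sigma x) by case: (sigmaP x).
pose N := regluing finF s1 s2.
pose phi : homeo M N := to_regluing finF s1 s2.
exists N, phi; split => //; first exact: to_regluing_finitely_singular.
(* [T] is contained in the discrepancy set, hence finite; unlike that set, it is always
   invariant. *)
pose T := [set x | ~ exists c, germ_fiber B x = [set c]].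
have finT : finite_set T.
  by apply: (sub_finite_set _ finF) => x nx Bx; apply: nx; exists (manifold_germ x).
have fiber_act g x c : germ_fiber B x c ->
    germ_fiber B (val (rho g) x) (act g c).
  by apply: germ_fiber_act => //; exact: invB.
have fiberT g x c : germ_fiber B x = [set c] ->
    germ_fiber B (val (rho g) x) = [set act g c].
  move=> Bx; apply/seteqP; split => [b Bb|_ ->]; last by apply: fiber_act; rewrite Bx.
  (* Acting by the inverse of [g] brings [b] back into the fibre over [x], which is [[set c]]. *)
  have := fiber_act g^-1%g _ _ Bb; rewrite rhoV Bx => <-.
  by rewrite -actP.2 mulgV actP.1.
have invT g x : T x -> T (val (rho g) x).
  move=> nx [c Bc]; apply: nx; exists (act g^-1%g c).
  by have := fiberT g^-1%g _ _ Bc; rewrite rhoV.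
(* [phi] is the identity on points: only the structure changes, not the maps. *)
have LE : conj_group phi [set val (rho g) | g in [set: Gam]] =
    [set val (rho g) | g in [set: Gam]].
  apply/seteqP; split => f.
    by move=> [_ [g _ <-] <-]; exists g => //; exact: homeo_eq.
  move=> [g _ <-]; exists (val (rho g)); first by exists g.
  exact: homeo_eq.
have singT x : singular_point (N := N)
    (conj_group phi [set val (rho g) | g in [set: Gam]]) x -> T x.
  rewrite LE => -[_ [g _ <-]]; apply: contra_notP => /contrapT[c Bc].
  apply: regluing_regular_at.
  (* Both fibres are singletons, so the structure of [N] is [c] at [x] and [act g c] at the
     image. *)
  have [_ _ /(_ _ Bc) <-] := sigmaP x.
  by have [_ _ /(_ _ (fiberT g _ _ Bc)) <-] := sigmaP (val (rho g) x).
split; first exact: (sub_finite_set _ finT).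
move=> x /singT Tx; apply: (sub_finite_set _ finT) => _ [f Lf <-].
by move: Lf; rewrite LE => -[g _ <-]; exact: invT.
Qed.
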